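(* Let $X$ be a locally compact non-separable metrizable space. Then $$\mathcal{E}_S(X)=\{Y\in\mathcal{E}(X):Y\geq S\text{ for some }S\in\mathcal{E}_K(X)\}.$$
   Context: For a non-compact metrizable space $X$, $\mathcal{E}(X)$ denotes the set of all one-point metrizable extensions of $X$, i.e. metrizable spaces $Y=X\cup\{p\}$ with $p\notin X$ containing $X$ as a dense subspace, where two such extensions are identified if there is a homeomorphism between them fixing $X$ pointwise. $\mathcal{E}(X)$ is partially ordered by: $Y_1\leq Y_2$ if there is a continuous function from $Y_2$ into $Y_1$ fixing $X$ pointwise. For $X$ locally compact, $\mathcal{E}_K(X)$ is the set of those elements of $\mathcal{E}(X)$ that are locally compact. For $X$ locally compact non-separable metrizable, $\mathcal{E}_S(X)$ is the set of those $Y=X\cup\{p\}\in\mathcal{E}(X)$ such that $p$ has a separable neighborhood in $Y$. *)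

(* Defs.v *)
From HB Require Import structures.
From mathcomp Require Import all_boot all_order all_algebra.
From mathcomp Require Import boolp classical_sets functions cardinality.
From mathcomp Require Import reals topology.

Set Implicit Arguments.
Unset Strict Implicit.
Unset Printing Implicit Defensive.

Local Open Scope classical_set_scope.

(* There is a metric structure [m] on the carrier of [T], with distances in
   [R], whose topology (the right-hand [nbhs]) is the given one. *)
Definition metrizable (R : realType) (T : topologicalType) : Prop :=
  exists m : Metric R T,
    forall x : T, nbhs x = @nbhs (Metric.Pack m) (Metric.Pack m) x.

Definition separable (T : topologicalType) : Prop :=
  exists2 D : set T, countable D & dense D.

(* The inclusion of [X] in [Y] = [X] + one point is an embedding [ext_incl] in a
   space with an arbitrary carrier, and the added point is [ext_pt]. *)
Record extension (R : realType) (X : topologicalType) := Extension {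
  ext_space :> topologicalType ;
  ext_incl : X -> ext_space ;
  ext_pt : ext_space ;
  ext_incl_inj : injective ext_incl ;
  ext_pt_notin : ~ range ext_incl ext_pt ;
  ext_cover : range ext_incl `|` [set ext_pt] = [set: ext_space] ;
  ext_subspace : forall A : set X,
    open A <-> exists2 V : set ext_space, open V & ext_incl @^-1` V = A ;
  ext_dense : dense (range ext_incl) ;
  ext_metrizable : metrizable R ext_space
}.

Section extension_classes.
Context {R : realType} {X : topologicalType}.
Implicit Types Y Z : extension R X.

Definition fixes_base Y Z (f : Y -> Z) : Prop :=
  forall x : X, f (ext_incl Y x) = ext_incl Z x.

Definition ext_equiv Y Z : Prop :=
  exists (f : Y -> Z) (g : Z -> Y),
    [/\ cancel f g, cancel g f, continuous f, continuous g & fixes_base f].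

Definition ext_le Y Z : Prop :=
  exists2 f : Z -> Y, continuous f & fixes_base f.

Definition separable_at_pt Y : Prop :=
  exists2 U : set Y, nbhs (ext_pt Y) U & separable (set_type U).

Lemma ext_equiv_refl Y : ext_equiv Y Y.
Proof. by exists id, id; split => //; move=> x; exact: cvg_id. Qed.

Lemma ext_equiv_sym Y Z : ext_equiv Y Z -> ext_equiv Z Y.
Proof.
case=> f [g [fK gK cf cg fb]]; exists g, f; split => // x.
by rewrite -fb fK.
Qed.

Lemma ext_equiv_trans Y Z W : ext_equiv Y Z -> ext_equiv Z W -> ext_equiv Y W.
Proof.
case=> f [g [fK gK cf cg fb]] [h [k [hK kK ch ck hb]]].
exists (h \o f), (g \o k); split.
- by move=> y /=; rewrite hK fK.
- by move=> w /=; rewrite gK kK.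
- by move=> y; apply: continuous_comp; [exact: cf|exact: ch].
- by move=> w; apply: continuous_comp; [exact: ck|exact: cg].
- by move=> x /=; rewrite fb hb.
Qed.

End extension_classes.

(* The elements of E(X): equivalence classes of extensions. Because of the
   arbitrary carriers, the universe of this type is too large for [set], so that
   subsets of E(X) are plain predicates. *)
Record calE (R : realType) (X : topologicalType) := ExtClass {
  ext_rep :> extension R X -> Prop ;
  ext_repP : exists Y, forall Z, ext_rep Z <-> ext_equiv Y Z
}.

Section calE_theory.
Context {R : realType} {X : topologicalType}.
Implicit Types (C D : calE R X) (Y Z : extension R X).

(* The order and the two subsets do not depend on the representatives, see
   [calE_leP], [calE_KP] and [calE_SP]. *)
Definition calE_le C D : Prop :=
  exists Y Z, [/\ C Y, D Z & ext_le Y Z].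

Definition calE_K C : Prop :=
  exists2 Y, C Y & locally_compact [set: Y].

Definition calE_S C : Prop :=
  exists2 Y, C Y & separable_at_pt Y.

Lemma ext_rep_equiv C Y Z : C Y -> C Z <-> ext_equiv Y Z.
Proof.
have [W CW] := ext_repP C; move=> /CW WY; split.
  by move=> /CW WZ; exact: ext_equiv_trans (ext_equiv_sym WY) WZ.
by move=> YZ; apply/CW; exact: ext_equiv_trans WY YZ.
Qed.

Lemma calE_leP C D Y Z : C Y -> D Z -> calE_le C D <-> ext_le Y Z.
Proof.
move=> CY DZ; split; last by exists Y, Z.
case=> Y' [Z' [CY' DZ' [f cf fb]]].
have [g [_ [_ _ cg _ gb]]] := (ext_rep_equiv _ CY').1 CY.
have [h [_ [_ _ ch _ hb]]] := (ext_rep_equiv _ DZ).1 DZ'.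
exists (g \o f \o h) => [z|x /=]; last by rewrite hb fb gb.
by do 2![apply: continuous_comp; first exact: ch || exact: cf]; exact: cg.
Qed.

Lemma calE_KP C Y : C Y -> calE_K C <-> locally_compact [set: Y].
Proof.
move=> CY; split; last by exists Y.
case=> Z CZ lcZ.
have [f [g [fK gK cf cg _]]] := (ext_rep_equiv _ CY).1 CZ.
move=> y _; have [U fyU [cU clU]] := lcZ (f y) I.
exists (f @^-1` U).
  by have /= /cf := fyU; rewrite /within /prop_near1 /nbhs/=.
split; last by exact: preimage_closed.
rewrite (_ : f @^-1` U = g @` U).
  by apply: continuous_compact => //; exact: continuous_subspaceT.
rewrite eqEsubset; split=> [x Ufx|_ [z Uz <-]]; last by rewrite /preimage/= gK.
by exists (f x).
Qed.

Lemma calE_SP C Y : C Y -> calE_S C <-> separable_at_pt Y.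
Proof.
move=> CY; split; last by exists Y.
case=> Z CZ [U ZU [D ctD dD]].
have [f [g [fK gK cf cg fb]]] := (ext_rep_equiv _ CY).1 CZ.
have fpt : f (ext_pt Y) = ext_pt Z.
  have : [set: Z] (f (ext_pt Y)) by [].
  rewrite -(ext_cover Z) => -[[x _ xp]|//]; exfalso.
  apply: (@ext_pt_notin _ _ Y); exists x => //.
  by rewrite -[RHS]fK -xp -fb fK.
have hP (u : set_type U) : g (set_val u) \in f @^-1` U.
  by rewrite inE /preimage/= gK; exact: set_mem (valP u).
pose h (u : set_type U) : set_type (f @^-1` U) := @exist _ _ (g (set_val u)) (hP u).
exists (f @^-1` U); first by apply: cf; rewrite fpt.
exists (h @` D).
  exact: sub_countable (card_image_le _ _) ctD.
move=> O [y Oy] [W oW WO]; rewrite -{}WO in Oy *.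
have fyU : f (set_val y) \in U by have := valP y; rewrite !inE.
have [| |u [Wu Du]] := dD (set_val @^-1` (g @^-1` W)).
- by exists (@exist _ _ (f (set_val y)) fyU); rewrite /preimage/= fK.
- exists (g @^-1` W) => //; apply: open_comp => // *; exact: cg.
by exists (h u); split=> //; exists u.
Qed.

End calE_theory.

(* Main.v *)
From HB Require Import structures.
Require Import Defs.
From mathcomp Require Import all_boot all_order all_algebra.
From mathcomp Require Import boolp classical_sets functions cardinality.
From mathcomp Require Import reals topology.
From mathcomp Require Import lra.

(** Why the theorem is true.

  If [S] is locally compact and [f : Y -> S] is continuous and fixes [X], then
  [f] sends the added point of [Y] to that of [S] ([fixes_base_pt]). Let [K] be
  a compact neighbourhood of the added point of [S]. As [f] is injective, the
  neighbourhood [f @^-1` K] of the added point of [Y] consists of this point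
  and of the trace of [K] on [X]. Subsets of a compact metrizable space are
  separable ([compact_countable_dense]), so [f @^-1` K] is separable.

  Conversely, let [U] be a separable neighbourhood of the added point of [Y].
  The trace of [U] on [X] lies in a clopen sigma-compact subset [A] of [X]
  ([clopen_exhaustion]), and [S] is the topological sum of [X `\` A] and the
  one-point compactification of [A]. The obvious map from [Y] to [S] is
  continuous: a neighbourhood of the added point of [S] contains [A] minus a
  compact set [C], and [U] minus [C] is still a neighbourhood of the added
  point of [Y].

  The set [A] comes from the radius of local compactness
  [r x = sup {s <= 1 | the ball of radius s at x is precompact}]. It is
  positive and 1-Lipschitz. If [z] is in [K], add all points at distance less
  than [r z / 2] from [z]; iterating this, a compact set only grows to a
  precompact one, and the union of the iterates is open. It is closed because
  a point [y] of its closure has a point [x] of the union within [r y / 4],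
  and the Lipschitz property puts [y] within [r x / 2] of [x].

  To see that [S] is metrizable, the topology is given from the start by a
  distance. On [A], a positive continuous function [phi] tends to 0 at infinity
  ([vanishing_function]), and [phi = 1] off [A]. Once [d] is changed to make
  [phi] 1-Lipschitz, the formulas [min (d x y) (phi x + phi y)] and, for the
  distance from [x] to the added point, [phi x] define a distance on
  [option X] ([one_point_extension]): it is as if one could jump from any [x]
  to the added point at the cost [phi x]. *)

Set Implicit Arguments.
Unset Strict Implicit.
Unset Printing Implicit Defensive.

Import Order.TTheory GRing.Theory Num.Theory.

Local Open Scope classical_set_scope.
Local Open Scope ring_scope.

(** * Metrizable spaces through a distance function *)

Record is_distance (R : realType) (T : Type) (d : T -> T -> R) : Prop :=
  IsDistance {
    dist_xx : forall x, d x x = 0 ;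
    dist_eq0 : forall x y, d x y = 0 -> x = y ;
    dist_sym : forall x y, d x y = d y x ;
    dist_triangle : forall y x z, d x z <= d x y + d y z
  }.

Lemma dist_ge0 (R : realType) (T : Type) (d : T -> T -> R) :
  is_distance d -> forall x y, 0 <= d x y.
Proof.
move=> [d0 _ ds dt] x y.
have := dt y x x; rewrite d0 (ds y x); lra.
Qed.

Definition metrizes (R : realType) (T : topologicalType) (d : T -> T -> R) :=
  is_distance d /\ forall x B,
    nbhs x B <-> exists2 e, 0 < e & forall y, d x y < e -> B y.

Lemma metrizable_dist (R : realType) (T : topologicalType) :
  metrizable R T -> exists d : T -> T -> R, metrizes d.
Proof.
case=> m mT; pose M : metricType R := Metric.Pack m.
exists (@mdist R M); split.
  split; [exact: (@mdistxx R M)|exact: (@mdist_positivity R M)|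
    exact: (@metric_sym R M)|move=> y x z; exact: (@metric_triangle R M)].
move=> x B; rewrite mT.
rewrite -(@metricType_numDomainType.filter_from_mdist_nbhs R M x).
by split=> -[e e0 eB]; exists e.
Qed.

(** A carrier to which the topology of a distance can be attached, also when the
    type [T] has a topology of its own. *)
Definition dist_space (R : realType) (T : choiceType) (d : T -> T -> R)
  (dP : is_distance d) : Type := T.

HB.instance Definition _ (R : realType) (T : choiceType) (d : T -> T -> R)
    (dP : is_distance d) := Choice.on (@dist_space R T d dP).
HB.instance Definition _ (R : realType) (T : choiceType) (d : T -> T -> R)
    (dP : is_distance d) :=
  @isMetric.Build R (@dist_space R T d dP) d
    (dist_xx dP) (dist_eq0 dP) (dist_sym dP) (dist_triangle dP).

Lemma dist_space_metrizable R T d dP :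
  metrizable R (@dist_space R T d dP).
Proof. by exists (Metric.class (@dist_space R T d dP)). Qed.

Lemma dist_space_nbhs R T d dP (x : @dist_space R T d dP) B :
  nbhs x B <-> exists2 e, 0 < e & forall y, d x y < e -> B y.
Proof.
rewrite -(@metricType_numDomainType.filter_from_mdist_nbhs R _ x).
by split=> -[e e0 eB]; exists e.
Qed.

Section metrized.
Context {R : realType} {T : topologicalType} {d : T -> T -> R}.
Hypothesis dT : metrizes d.
Let dP := dT.1.
Let nP := dT.2.

Lemma near_dist (x : T) (e : R) : 0 < e -> \forall y \near x, d x y < e.
Proof. by move=> e0; apply/nP; exists e. Qed.

Lemma metrizes_hausdorff : hausdorff_space T.
Proof.
move=> x y xy; apply: (dist_eq0 dP); apply/eqP; rewrite eq_le (dist_ge0 dP).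
rewrite andbT leNgt; apply/negP => d0.
have e0 : 0 < d x y / 2 by lra.
have [z [xz yz]] := xy _ _ (near_dist x e0) (near_dist y e0).
have := dist_triangle dP z x y; rewrite (dist_sym dP z y) leNgt => /negP; apply.
move: xz yz => /=; lra.
Qed.

End metrized.

(** * Compact sets and countable dense subsets *)

(** Compactness in the form in which it is used below: a family [I] of sets that
    is closed under finite unions, and that locally contains what is required
    ([Q]), contains it on all of [K]. With the precompact sets for [I] this
    bounds a neighbourhood of [K]; with the countable sets it gives nets in
    [K]. The proof applies near-coverings to the filter of the large members
    of [I]. *)
Lemma compact_ideal (T : topologicalType) (J : Type) (I : set (set J))
    (Q : T -> set J -> Prop) (K : set T) :
  I set0 -> (forall A B, I A -> I B -> I (A `|` B)) ->
  (forall x A B, A `<=` B -> Q x A -> Q x B) ->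
  compact K ->
  (forall x, K x -> exists2 A, I A & \forall y \near x, Q y A) ->
  exists2 A, I A & forall x, K x -> Q x A.
Proof.
move=> I0 IU Qmon /compact_near_coveringP cK KQ.
pose F := filter_from I (fun A => [set B | I B /\ A `<=` B]).
have FF : Filter F.
  apply: filter_from_filter; first by exists set0.
  move=> A B IA IB; exists (A `|` B); first exact: IU.
  move=> C [IC ABC]; split; split=> // z Cz; apply: ABC; [by left|by right].
have [|A IA AP] := cK _ F (fun A x => Q x A) FF.
  move=> x /KQ [A IA nA]; exists ([set y | Q y A], [set B | I B /\ A `<=` B]).
    by split=> //=; exists A.
  by move=> [y B] /= [QA [_ AB]]; exact: Qmon QA.
exists A => //; apply: AP; split=> //.
Qed.

Lemma countableU (T : Type) (A B : set T) :
  countable A -> countable B -> countable (A `|` B).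
Proof.
move=> cA cB; rewrite -bigcup2E; apply: bigcup_countable => // i _.
by rewrite /bigcup2; case: (i == 0)%N => //; case: (i == 1)%N.
Qed.

Lemma countable_inj_on (T U : Type) (g : T -> U) (E : set T) (D : set U) :
  countable D -> (forall x, E x -> D (g x)) ->
  (forall x y, E x -> E y -> g x = g y -> x = y) -> countable E.
Proof.
move=> /countable_injP[h hD] ED gE; apply/countable_injP; exists (h \o g).
move=> x y /set_mem Ex /set_mem Ey /= hxy; apply: gE => //.
by apply: hD => //; rewrite inE; exact: ED.
Qed.

(** For each [n] there is a countable [1/(n+1)]-net of [B]. The points of the
    net must be in [B] itself, so a small ball around a point of [K] contributes one
    of its points in [B] if there is one, and nothing otherwise. *)
Lemma compact_countable_dense (R : realType) (T : topologicalType)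
    (d : T -> T -> R) (K B : set T) :
  metrizes d -> compact K -> B `<=` K ->
  exists D, [/\ countable D, D `<=` B & B `<=` closure D].
Proof.
move=> dT cK BK; have dP := dT.1.
have net (n : nat) : exists C, [/\ countable C, C `<=` B &
    forall x, K x -> B x -> exists2 c, C c & d c x < n.+1%:R^-1].
  have e0 : 0 < n.+1%:R^-1 / 2 :> R by rewrite divr_gt0 ?invr_gt0.
  suff [C [ctC CB] CP] : exists2 C, countable C /\ C `<=` B &
      forall x, K x -> B x -> exists2 c, C c & d c x < n.+1%:R^-1 by exists C.
  apply: (compact_ideal (I := [set C | countable C /\ C `<=` B]) _ _ _ cK).
  - by split.
  - move=> A1 A2 [c1 s1] [c2 s2]; split; last by move=> z [/s1|/s2].
    exact: countableU.
  - by move=> x A1 A2 s12 h /h [c /s12]; exists c.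
  (* Halving the radius makes one point of [B] serve for all nearby points. *)
  - move=> x Kx.
    have [[c [Bc cx]]|h] := pselect (exists c, B c /\ d x c < n.+1%:R^-1 / 2).
      exists [set c]; first by split=> // _ ->.
      apply: filterS (near_dist dT x e0) => y xy _; exists c => //.
      apply: le_lt_trans (dist_triangle dP x c y) _; rewrite (dist_sym dP c x).
      move: cx xy => /=; move: (_^-1) => e; lra.
    exists set0; first by split.
    apply: filterS (near_dist dT x e0) => y xy By.
    by exfalso; apply: h; exists y.
have /choice [C CP] := net.
exists (\bigcup_n C n); split.
- by apply: bigcup_countable => // n _; have [] := CP n.
- by move=> x [n _]; have [_ + _] := CP n; exact.
move=> x Bx V /dT.2 [e e0 eV].
have [n ne] : exists n : nat, n.+1%:R^-1 < e.
  exists (Num.trunc e^-1); rewrite -[ltRHS]invrK ltf_pV2 ?posrE ?invr_gt0//.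
  exact: truncnS_gt.
have [_ _ /(_ x (BK _ Bx) Bx) [c Cc cx]] := CP n.
exists c; split; first by exists n.
by apply: eV; rewrite (dist_sym dP); exact: lt_trans cx ne.
Qed.

(** * Suprema of radii

    For a property [P s B] that is inherited by smaller radii [s] and smaller
    sets [B], the largest radius [s <= 1] such that the ball at [x] of radius
    [s] satisfies [P s] depends on [x] in a 1-Lipschitz way: the ball of radius
    [s - d x y] at [y] lies in the ball of radius [s] at [x]. The radius of local
    compactness and the function that vanishes at infinity are both of this
    form. *)

Section lip_sup.
Context {R : realType} {T : topologicalType} (d : T -> T -> R).
Hypothesis dT : metrizes d.
Variables (P : R -> set T -> Prop).
Hypothesis P0 : P 0 set0.
Hypothesis Pmon : forall s t A B, t <= s -> A `<=` B -> P s B -> P t A.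
Let dP := dT.1.

Definition lip_set (x : T) :=
  [set s : R | 0 <= s <= 1 /\ P s [set y | d x y < s]].

Definition lip_sup (x : T) : R := sup (lip_set x).

Let lip_set0 x : lip_set x 0.
Proof.
split; first by rewrite lexx ler01.
apply: Pmon P0 => // y /=; have := dist_ge0 dP x y; lra.
Qed.

Let lip_set_sup x : has_sup (lip_set x).
Proof. by split; [exists 0|exists 1 => s [/andP[]]]. Qed.

Lemma lip_sup_ge x s : 0 <= s <= 1 -> P s [set y | d x y < s] -> s <= lip_sup x.
Proof. by move=> s01 Ps; apply: sup_upper_bound => //; split. Qed.

Lemma lip_sup_ge0 x : 0 <= lip_sup x.
Proof. exact: sup_upper_bound. Qed.

Lemma lip_sup_gt x t : t < lip_sup x -> P t [set y | d x y < t].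
Proof.
move=> tx; have e0 : 0 < lip_sup x - t by rewrite subr_gt0.
have [s [s01 Ps]] := sup_adherent e0 (lip_set_sup x).
rewrite -/(lip_sup x) opprB addrC subrK => ts.
by apply: Pmon Ps; [exact: ltW|move=> y /= xy; exact: lt_trans ts].
Qed.

Lemma lip_sup_lip x y : lip_sup x <= lip_sup y + d x y.
Proof.
apply: sup_le_ub; first by exists 0.
move=> s [/andP[s0 s1] Ps].
have [sxy|xys] := leP s (d x y).
  by apply: (le_trans sxy); rewrite lerDr lip_sup_ge0.
rewrite -lerBlDr; apply: lip_sup_ge.
  have := dist_ge0 dP x y; lra.
apply: Pmon Ps; first by have := dist_ge0 dP x y; lra.
by move=> z /= yz; have := dist_triangle dP y x z; lra.
Qed.

End lip_sup.

(** * Clopen sigma-compact sets and functions vanishing at infinity *)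

Lemma locally_compact_nbhs (T : topologicalType) (x : T) :
  locally_compact [set: T] -> exists2 C, nbhs x C & compact C /\ closed C.
Proof.
move=> lcT; have [C xC cC] := lcT x I; exists C => //.
by apply: filterS (xC : nbhs x [set y | [set: T] y -> C y]) => y; exact.
Qed.

Lemma precompactU (T : topologicalType) (A B : set T) :
  precompact A -> precompact B -> precompact (A `|` B).
Proof.
move=> [C AC [cC clC]] [E BE [cE clE]]; exists (C `|` E).
  by move=> x [/AC|/BE]; [left|right].
by split; [exact: compactU|exact: closedU].
Qed.

Lemma precompact_set0 (T : topologicalType) : precompact (@set0 T).
Proof. by exists set0 => //; split; [exact: compact0|exact: closed0]. Qed.

Section exhaustion.
Context {R : realType} {X : topologicalType} {d : X -> X -> R}.
Hypotheses (dX : metrizes d) (lcX : locally_compact [set: X]).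
Let dP := dX.1.

Let lcP (s : R) (B : set X) : Prop := precompact B.

Definition lc_radius : X -> R := lip_sup d lcP.

Let lcP0 : lcP 0 set0.
Proof. exact: precompact_set0. Qed.

Let lcP_mon (s t : R) (A B : set X) : t <= s -> A `<=` B -> lcP s B -> lcP t A.
Proof. by move=> _; exact: precompact_subset. Qed.

Lemma lc_radius_gt0 x : 0 < lc_radius x.
Proof.
have [U /dX.2 [e e0 eU] cU] := locally_compact_nbhs x lcX.
have m0 : 0 < Num.min e 1 by rewrite lt_min e0 ltr01.
apply: (lt_le_trans m0); apply: (lip_sup_ge dX lcP0 lcP_mon).
  by rewrite ltW//= ge_min lexx orbT.
exists U => // y /=; rewrite lt_min => /andP[xy _]; exact: eU.
Qed.

Definition thicken (K : set X) : set X :=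
  [set y | exists2 z, K z & d z y < lc_radius z / 2].

(** Near a point [x] of [K], all the balls added to [K] lie in one precompact
    ball at [x]: if [d x z < r / 8] with [r] the radius at [x], then the radius
    at [z] is at most [9 r / 8], and [1/8 + 9/16 < 3/4]. *)
Lemma thicken_precompact K : compact K -> precompact (thicken K).
Proof.
move=> cK.
have [C pC KC] : exists2 C, precompact C & forall x, K x ->
    [set y | d x y < lc_radius x / 2] `<=` C.
  apply: (compact_ideal (I := precompact) _ _ _ cK).
  - exact: precompact_set0.
  - exact: precompactU.
  - by move=> x A B AB xA y /xA /AB.
  - move=> x Kx; have r0 := lc_radius_gt0 x.
    exists [set y | d x y < 3 / 4 * lc_radius x].
      by apply: (lip_sup_gt dX lcP0 lcP_mon); rewrite -/(lc_radius x); lra.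
    have r8 : 0 < lc_radius x / 8 by lra.
    apply: filterS (near_dist dX x r8) => z /= xz y /= zy.
    have := lip_sup_lip dX lcP0 lcP_mon z x.
    rewrite -!/(lc_radius _) (dist_sym dP z x).
    have := dist_triangle dP z x y; lra.
by apply: precompact_subset pC => y [z Kz zy]; exact: KC zy.
Qed.

(** Each [K n.+1] is a compact neighbourhood of [K n] that absorbs at most one more
    point of [D]. The union is closed because the size of the neighbourhoods is
    governed by a Lipschitz function of the point only, not of [n]. *)
Lemma clopen_exhaustion (D : set X) : countable D ->
  exists K : nat -> set X, [/\ forall n, compact (K n),
    forall n, K n `<=` (K n.+1)°, closed (\bigcup_n K n) &
    D `<=` \bigcup_n K n].
Proof.
move=> /countable_injP[f fD].
(* At most one point: the one that the enumeration of [D] puts in place [n]. *)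
pose L n := [set x | D x /\ f x = n].
have cL n : compact (L n).
  have [[x [Dx fx]]|L0] := pselect (exists x, L n x).
    suff -> : L n = [set x] by exact: compact_set1.
    apply/seteqP; split=> [y [Dy fy]|_ ->//].
    by apply: fD; rewrite ?inE// fx fy.
  suff -> : L n = set0 by exact: compact0.
  by rewrite -subset0 => x Lx; apply: L0; exists x.
pose K := fix K n := if n is n'.+1 then closure (thicken (K n' `|` L n'))
                     else set0.
have cK n : compact (K n).
  elim: n => [|n IH] /=; first exact: compact0.
  by rewrite -precompactE; apply: thicken_precompact; exact: compactU.
have ball_thick n z : K n z \/ L n z ->
    [set y | d z y < lc_radius z / 2] `<=` K n.+1.
  by move=> zKL y zy; apply: subset_closure; exists z.
have r2 z : 0 < lc_radius z / 2 by have := lc_radius_gt0 z; lra.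
exists K; split => //.
- move=> n z Kz; apply: filterS (near_dist dX z (r2 z)).
  by apply: ball_thick; left.
- move=> y /= cly; have r4 : 0 < lc_radius y / 4 by have := r2 y; lra.
  have [x [[n _ Kx] yx]] := cly _ (near_dist dX y r4).
  exists n.+1 => //; apply: (@ball_thick n x); first by left.
  have := lip_sup_lip dX lcP0 lcP_mon y x.
  rewrite -!/(lc_radius _) /= (dist_sym dP x y).
  by move: yx => /=; lra.
- move=> x Dx; exists (f x).+1 => //; apply: (@ball_thick (f x) x).
    by right.
  by rewrite /= (dist_xx dP).
Qed.

(** On the clopen union of an exhaustion [K], [phi x] is the supremum of the [s]
    for which the ball of radius [s] at [x] lies in some [K n] with
    [s * (n + 2) <= 1]; a value at least [e] thus bounds [n], and confines [x] to a compact set. The [2]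
    keeps these values below the value 1 that [phi] takes off the union. *)
Lemma vanishing_function (D : set X) : countable D ->
  exists phi : X -> R, [/\ forall x, 0 < phi x,
    forall x e, 0 < e -> \forall y \near x, `|phi x - phi y| < e,
    forall e, 0 < e -> precompact [set x | e <= phi x < 1] &
    closure D `<=` [set x | phi x < 1]].
Proof.
move=> /clopen_exhaustion[K [cK Kint clA DA]].
pose P (s : R) B := exists2 n, s * n.+2%:R <= 1 & B `<=` K n.
have P0 : P 0 set0 by exists 0%N => //; rewrite mul0r ler01.
have Pmon s t A B : t <= s -> A `<=` B -> P s B -> P t A.
  move=> ts AB [n sn BK]; exists n; last by move=> x /AB/BK.
  by apply: le_trans sn; rewrite ler_wpM2r.
pose A := \bigcup_n K n.
pose phi0 := lip_sup d P.
pose phi x := if asbool (A x) then phi0 x else 1.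
have phiA x : A x -> phi x = phi0 x by move=> Ax; rewrite /phi asboolT.
have phiNA x : ~ A x -> phi x = 1 by move=> Ax; rewrite /phi asboolF.
have oA x : A x -> nbhs x A.
  by case=> n _ /Kint; apply: filterS => y Ky; exists n.+1.
have phi0_gt0 x : A x -> 0 < phi0 x.
  move=> [n _ /Kint /dX.2 [e e0 eK]].
  have n0 : 0 < n.+3%:R^-1 :> R by rewrite invr_gt0.
  have m0 : 0 < Num.min e n.+3%:R^-1 by rewrite lt_min e0 n0.
  have mn : Num.min e n.+3%:R^-1 <= n.+3%:R^-1 by rewrite ge_min lexx orbT.
  apply: (lt_le_trans m0); apply: (lip_sup_ge dX P0 Pmon).
    by rewrite ltW//= (le_trans mn)// invf_le1 ?ler1n.
  exists n.+1; first by rewrite -ler_pdivlMr// div1r.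
  by move=> y /=; rewrite lt_min => /andP[xy _]; exact: eK.
have phi0_lt1 x : phi0 x < 1.
  rewrite ltNge; apply/negP => x1.
  have [|n n1 _] := @lip_sup_gt _ _ _ dX P P0 Pmon x (3 / 4).
    by rewrite -/(phi0 x); lra.
  have : 2 <= n.+2%:R :> R by rewrite ler_nat.
  by lra.
exists phi; split => //.
- move=> x; have [Ax|Ax] := pselect (A x); last by rewrite phiNA ?ltr01.
  by rewrite phiA// phi0_gt0.
- move=> x e e0; have [Ax|Ax] := pselect (A x).
    near=> y; have Ay : A y by near: y; exact: oA.
    have xy : d x y < e by near: y; exact: near_dist.
    rewrite !phiA// ltr_norml.
    have := lip_sup_lip dX P0 Pmon x y; have := lip_sup_lip dX P0 Pmon y x.
    by rewrite (dist_sym dP y x) -/(phi0 x) -/(phi0 y); lra.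
  have : nbhs x (~` A).
    by apply: open_nbhs_nbhs; split=> //; exact: closed_openC.
  by apply: filterS => y Ay; rewrite !phiNA// subrr normr0.
- move=> e e0.
  (* [e / 2] because a supremum at least [e] need not be attained. *)
  have [N eN] : exists N, forall n, e / 2 * n.+2%:R <= 1 -> (n <= N)%N.
    exists (Num.trunc (2 / e)) => n en.
    rewrite -ltnS -(ltr_nat R); apply: le_lt_trans (truncnS_gt _).
    rewrite ler_pdivlMr//; apply: le_trans (_ : e * n.+2%:R <= _).
      by rewrite mulrC ler_pM2l// ler_nat ltnW.
    lra.
  have Kmon : {homo K : m n / (m <= n)%N >-> m `<=` n}.
    apply: homo_leq; [by move=> ?|by move=> ? ? ?; exact: subset_trans|].
    by move=> n x /Kint /nbhs_singleton.
  apply: (@precompact_subset _ _ (K N)).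
    move=> x /= /andP[ex x1].
    have Ax : A x by apply: contrapT => /phiNA x1'; rewrite x1' ltxx in x1.
    rewrite phiA// in ex.
    have [|n en xK] := @lip_sup_gt _ _ _ dX P P0 Pmon x (e / 2).
      by rewrite -/(phi0 x); lra.
    apply: (Kmon n); first exact: eN.
    by apply: xK; rewrite /= (dist_xx dP); lra.
  exact: compact_precompact (metrizes_hausdorff dX) (cK N).
- move=> x Dx /=; have Ax : A x by apply: clA; exact: closure_subset DA x Dx.
  by rewrite phiA.
Unshelve. all: by end_near. Qed.

End exhaustion.

(** * Adjoining a point at infinity *)

(** [phi x] is the distance from [x] to the added point; two points of [X] are
    joined either directly or through the added point. *)
Definition adjoin_dist (R : realType) (X : Type) (d : X -> X -> R)
    (phi : X -> R) (a b : option X) : R :=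
  match a, b with
  | Some x, Some y => Num.min (d x y) (phi x + phi y)
  | Some x, None => phi x
  | None, Some y => phi y
  | None, None => 0
  end.

(** The Lipschitz condition is what the triangle inequality between two points
    of [X] and the added point amounts to. *)
Lemma adjoin_dist_is_distance (R : realType) (X : Type) (d : X -> X -> R)
    (phi : X -> R) :
  is_distance d -> (forall x, 0 < phi x) ->
  (forall x y, phi x <= phi y + d x y) -> is_distance (adjoin_dist d phi).
Proof.
move=> dP phi0 philip.
have dge := dist_ge0 dP; have dt := dist_triangle dP; have ds := dist_sym dP.
split.
- move=> [x|] //=; rewrite (dist_xx dP).
  by have x0 := phi0 x; case: leP; lra.
- move=> [x|] [y|] //=; first last.
  + by move=> y0; exfalso; have := phi0 y; lra.
  + by move=> x0; exfalso; have := phi0 x; lra.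
  have x0 := phi0 x; have y0 := phi0 y.
  by case: leP => [_ /(dist_eq0 dP) ->//|_ xy0]; exfalso; lra.
- by move=> [x|] [y|] //=; rewrite ds [phi x + _]addrC.
- move=> [y|] [x|] [z|] //=.
  + have := (phi0 x, phi0 y, phi0 z) => -[[? ?] ?].
    have := (dt y x z, philip x y, philip z y, ds y z) => -[[[? ?] ?] ?].
    by case: (leP (d x z)); case: (leP (d x y)); case: (leP (d y z)); lra.
  + by have := (phi0 y, philip x y) => -[? ?]; case: (leP (d x y)); lra.
  + have := (phi0 y, philip z y, ds y z) => -[[? ?] ?].
    by case: (leP (d y z)); lra.
  + by have := phi0 y; lra.
  + by case: (leP (d x z)); lra.
  + by have := phi0 x; lra.
  + by have := phi0 z; lra.
  + by lra.
Qed.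

(** Adding the variation of a continuous function to a distance makes the
    function 1-Lipschitz without changing the topology. *)
Lemma metrizes_add_diff (R : realType) (X : topologicalType)
    (d : X -> X -> R) (phi : X -> R) :
  metrizes d ->
  (forall x e, 0 < e -> \forall y \near x, `|phi x - phi y| < e) ->
  metrizes (fun x y => d x y + `|phi x - phi y|).
Proof.
move=> dX phic; have dP := dX.1; have dge := dist_ge0 dP.
split.
  split.
  - by move=> x; rewrite (dist_xx dP) subrr normr0 addr0.
  - move=> x y dxy; apply: (dist_eq0 dP).
    by have := dge x y; have := normr_ge0 (phi x - phi y); lra.
  - by move=> x y; rewrite (dist_sym dP) distrC.
  - move=> y x z; have := dist_triangle dP y x z.
    by have := ler_distD (phi y) (phi x) (phi z); lra.
move=> x B; split.
  move=> /dX.2 [e e0 eB]; exists e => // y xy; apply: eB.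
  by have := normr_ge0 (phi x - phi y); lra.
move=> [e e0 eB]; have e2 : 0 < e / 2 by lra.
have := phic x _ e2; have := near_dist dX x e2.
by apply: filterS2 => y ? ?; apply: eB; lra.
Qed.

(** The added point is in the closure of [X] because [phi] has infimum 0, and
    the topology of [X] does not change because [phi] is positive: going
    from [x] through the added point costs more than [phi x]. *)
Lemma one_point_extension (R : realType) (X : topologicalType)
    (d : X -> X -> R) (phi : X -> R) :
  metrizes d -> (forall x, 0 < phi x) ->
  (forall x e, 0 < e -> \forall y \near x, `|phi x - phi y| < e) ->
  (forall e, 0 < e -> exists x, phi x < e) ->
  exists S : extension R X, forall V : set S,
    nbhs (ext_pt S) V <-> V (ext_pt S) /\
      exists2 e, 0 < e & forall x, phi x < e -> V (ext_incl S x).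
Proof.
move=> dX phi0 phic phiinf.
pose d' x y := d x y + `|phi x - phi y|.
have d'X : metrizes d' := metrizes_add_diff dX phic.
have philip x y : phi x <= phi y + d' x y.
  have := ler_norm (phi x - phi y).
  by rewrite /d'; have := dist_ge0 dX.1 x y; lra.
pose rhoP := adjoin_dist_is_distance d'X.1 phi0 philip.
pose S : topologicalType := dist_space rhoP.
have nS (a : S) B := dist_space_nbhs a B.
have nSome x (B : set S) : nbhs (Some x : S) B <-> nbhs x (fun y => B (Some y)).
  split.
    move=> /nS [e e0 eB]; apply: filterS (near_dist d'X x e0) => y xy.
    by apply: eB; rewrite /= gt_min xy.
  move=> /d'X.2 [e e0 eB]; apply/nS; exists (Num.min e (phi x)).
    by rewrite lt_min e0 phi0.
  move=> [y|] /=; last by rewrite lt_min ltxx andbF.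
  rewrite lt_min !gt_min => /andP[/orP xe /orP xx]; apply: eB.
  by have := phi0 x; have := phi0 y; case: xe; case: xx; lra.
have nNone (B : set S) : nbhs (None : S) B <-> B None /\
    exists2 e, 0 < e & forall x, phi x < e -> B (Some x).
  split.
    move=> /nS [e e0 eB]; split; first exact: eB.
    by exists e => // x xe; exact: eB.
  by move=> [BN [e e0 eB]]; apply/nS; exists e => // -[y|] //= /eB.
have Sinj : injective (Some : X -> S) by move=> x y [].
have Spt : ~ range (Some : X -> S) None by case.
have Scov : range (Some : X -> S) `|` [set None] = [set: S].
  by apply/seteqP; split=> // -[x|] _; [left; exists x|right].
have Ssub (A : set X) :
    open A <-> exists2 V : set S, open V & (Some : X -> S) @^-1` V = A.
  split=> [oA|[V oV <-]].
    exists (Some @` A); last first.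
      by apply/seteqP; split=> [x [y Ay [<-]]//|x Ax]; exists x.
    rewrite openE => _ [x Ax <-]; apply/nSome.
    by apply: filterS (open_nbhs_nbhs (conj oA Ax)) => y Ay; exists y.
  rewrite openE => x Vx; apply/nSome.
  exact: open_nbhs_nbhs (conj oV Vx).
have Sdense : dense (range (Some : X -> S)).
  move=> V [[x|] Vz] oV; first by exists (Some x); split=> //; exists x.
  have /nNone[_ [e e0 eV]] := open_nbhs_nbhs (conj oV Vz).
  have [x xe] := phiinf e e0.
  by exists (Some x); split; [exact: eV|exists x].
by exists (Extension Sinj Spt Scov Ssub Sdense (dist_space_metrizable rhoP)).
Qed.

(** * The topology of an extension *)

Section extension_topology.
Context {R : realType} {X : topologicalType} (Y : extension R X).

Lemma ext_case (y : Y) : y = ext_pt Y \/ exists x, y = ext_incl Y x.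
Proof.
have : [set: Y] y by [].
by rewrite -(ext_cover Y) => -[[x _ <-]|->]; [right; exists x|left].
Qed.

Lemma ext_hausdorff : hausdorff_space Y.
Proof.
have [d dY] := metrizable_dist (ext_metrizable Y).
exact: metrizes_hausdorff dY.
Qed.

Lemma ext_range_open : open (range (ext_incl Y)).
Proof.
rewrite (_ : range _ = ~` [set ext_pt Y]).
  apply: closed_openC; apply: compact_closed; first exact: ext_hausdorff.
  exact: compact_set1.
apply/seteqP; split=> [_ [x _ <-] /= xp|y /= yp].
  by apply: (@ext_pt_notin _ _ Y); exists x.
by have [//|[x ->]] := ext_case y; exists x.
Qed.

Lemma ext_nbhs (x : X) (B : set Y) :
  nbhs (ext_incl Y x) B <-> nbhs x (ext_incl Y @^-1` B).
Proof.
split; rewrite nbhsE => -[V [oV Vx] VB].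
  rewrite nbhsE; exists (ext_incl Y @^-1` V); last by move=> y /VB.
  by split=> //; apply/ext_subspace; exists V.
have [W oW WV] := (ext_subspace Y V).1 oV.
rewrite nbhsE; exists (W `&` range (ext_incl Y)).
  split; first by apply: openI => //; exact: ext_range_open.
  by split; [rewrite -WV in Vx|exists x].
by move=> _ [/[swap] [[y _ <-]] Wy]; apply: VB; rewrite -WV.
Qed.

Lemma ext_incl_continuous : continuous (ext_incl Y).
Proof. by move=> x B /ext_nbhs. Qed.

Lemma ext_incl_compact (C : set X) : compact C -> compact (ext_incl Y @` C).
Proof.
apply: continuous_compact; apply: continuous_subspaceT.
exact: ext_incl_continuous.
Qed.

Lemma ext_incl_closed (C : set X) : compact C -> closed (ext_incl Y @` C).
Proof. by move/ext_incl_compact; exact: compact_closed ext_hausdorff. Qed.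

End extension_topology.

(** At the added point, the neighbourhood where [phi <= 1/2] is compact: a
    neighbourhood of the added point covers all of it except for some
    [e <= phi <= 1/2], which is compact. *)
Lemma adjoined_locally_compact (R : realType) (X : topologicalType)
    (phi : X -> R) (S : extension R X) :
  locally_compact [set: X] -> (forall x, 0 < phi x) ->
  (forall x e, 0 < e -> \forall y \near x, `|phi x - phi y| < e) ->
  (forall e, 0 < e -> precompact [set x | e <= phi x < 1]) ->
  (forall V : set S, nbhs (ext_pt S) V <-> V (ext_pt S) /\
      exists2 e, 0 < e & forall x, phi x < e -> V (ext_incl S x)) ->
  locally_compact [set: S].
Proof.
move=> lcX phi0 phic phicpt nS s _.
suff [C sC cC] : exists2 C, nbhs s C & compact C.
  exists C; first by apply: filterS sC => y Cy _.
  by split=> //; exact: compact_closed (@ext_hausdorff _ _ S) cC.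
have [->{s}|[x ->{s}]] := ext_case s; last first.
  have [C xC [cC _]] := locally_compact_nbhs x lcX.
  exists (ext_incl S @` C).
    by apply/ext_nbhs; apply: filterS xC => y Cy; exists y.
  exact: ext_incl_compact.
have closed_phi e : closed [set x | e <= phi x <= 1 / 2].
  move=> x clx /=; apply/andP; split; rewrite leNgt; apply/negP => h.
    have h0 : 0 < e - phi x by lra.
    have [y [/= /andP[ey _]]] := clx _ (phic x _ h0).
    by rewrite /= ltr_norml; lra.
  have h0 : 0 < phi x - 1 / 2 by lra.
  have [y [/= /andP[_ ey]]] := clx _ (phic x _ h0).
  by rewrite /= ltr_norml; lra.
exists ([set ext_pt S] `|` ext_incl S @` [set x | phi x <= 1 / 2]).
  apply/nS; split; first by left.
  by exists (1 / 2) => [|x xh]; [lra|right; exists x => //=; exact: ltW].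
apply/compact_near_coveringP => I F P FF FP.
have [[V B] [/= /nS[Vp [e e0 eV]] FB] VBP] := FP _ (or_introl erefl).
have cK : compact [set x | e <= phi x <= 1 / 2].
  have [C eC [cC _]] := phicpt e e0.
  apply: subclosed_compact (closed_phi e) cC _ => x /= /andP[ex xh].
  by apply: eC; rewrite /= ex /=; lra.
have /compact_near_coveringP/(_ I F P FF) := ext_incl_compact (Y := S) cK.
have FPK y : (ext_incl S @` [set x | e <= phi x <= 1 / 2]) y ->
    \forall y' \near y & i \near F, P i y'.
  by move=> [x /= /andP[_ xh] <-]; apply: FP; right; exists x.
move=> /(_ FPK); apply: filterS2 FB => i iB iK _ [->|[x /= xh <-]].
  exact: (VBP (ext_pt S, i)).
have [ex|xe] := leP e (phi x); first by apply: iK; exists x => //=; rewrite ex.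
by apply: (VBP (ext_incl S x, i)); split => //; exact: eV.
Qed.

(** * The order on extensions *)

Section extension_order.
Context {R : realType} {X : topologicalType}.
Implicit Types Y S : extension R X.

(** If the added point went to some [x] in [X], then every neighbourhood of the
    added point would meet, at a point of [X], every neighbourhood of [x], since
    the map is the identity on [X]. *)
Lemma fixes_base_pt Y S (f : Y -> S) :
  continuous f -> fixes_base f -> f (ext_pt Y) = ext_pt S.
Proof.
move=> cf fb; have [//|[x fx]] := ext_case (f (ext_pt Y)); exfalso.
apply: (@ext_pt_notin _ _ Y); exists x => //.
apply: (@ext_hausdorff _ _ Y) => A B /ext_nbhs xA pB.
have : nbhs (ext_pt Y) (f @^-1` (ext_incl S @` (ext_incl Y @^-1` A)) `&` B).
  apply: filterI => //; apply: cf; rewrite fx; apply/ext_nbhs.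
  by apply: filterS xA => y Ay; exists y.
rewrite nbhsE => -[V [oV Vp] VAB].
have [_ [/[swap] [[y _ <-]] Vy]] := @ext_dense _ _ Y V (ex_intro _ _ Vp) oV.
have [[y' Ay' y'E] By] := VAB _ Vy; rewrite fb in y'E.
by exists (ext_incl Y y); split => //; rewrite -(ext_incl_inj y'E).
Qed.

(** The countable dense set of the preimage of [K] is the added point together
    with the preimage of a set that is dense in the trace of [K] on [X]. *)
Lemma locally_compact_le_separable Y S :
  locally_compact [set: S] -> ext_le S Y -> separable_at_pt Y.
Proof.
move=> lcS [f cf fb].
have [K pK [cK _]] := locally_compact_nbhs (ext_pt S) lcS.
have fp := fixes_base_pt cf fb.
have nU : nbhs (ext_pt Y) (f @^-1` K) by apply: cf; rewrite fp.
have [d dS] := metrizable_dist (ext_metrizable S).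
have [D [ctD DB BD]] := @compact_countable_dense _ _ _ K
  (K `&` range (ext_incl S)) dS cK (@subIsetl _ _ _).
exists (f @^-1` K) => //.
pose E : set (set_type (f @^-1` K)) :=
  [set u | set_val u = ext_pt Y] `|` [set u | D (f (set_val u))].
exists E.
  apply: countableU.
    apply: (@countable_inj_on _ _ set_val _ [set ext_pt Y]) => //.
    by move=> u v _ _; exact: val_inj.
  apply: (countable_inj_on (g := f \o set_val) ctD) => // u v Du Dv /= fuv.
  apply: val_inj => /=; have [_ [x _ xu]] := DB _ Du.
  have finj y x' : f y = ext_incl S x' -> y = ext_incl Y x'.
    have [->|[x'' ->]] := ext_case y; last by rewrite fb => /ext_incl_inj ->.
    rewrite fp => px; exfalso.
    by apply: (@ext_pt_notin _ _ S); exists x'.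
  have ux := finj _ _ (esym xu).
  exact: etrans ux (esym (finj _ _ (etrans (esym fuv) (esym xu)))).
move=> O [[y yK] Oy] [W oW WO]; rewrite -{}WO in Oy *.
have Ky : K (f y) := set_mem yK.
have [yp|[x yx]] := ext_case y.
  by exists (exist _ y yK); split=> //; left.
(* The trace of [W] on [X] is also the trace of an open set of [S]. *)
have [V oV VW] := (ext_subspace S (ext_incl Y @^-1` W)).1
  ((ext_subspace Y _).2 (ex_intro2 _ _ W oW erefl)).
have Vx : V (ext_incl S x).
  suff : (ext_incl S @^-1` V) x by [].
  by rewrite VW /= -yx.
have Bx : (K `&` range (ext_incl S)) (ext_incl S x).
  by split; [rewrite -fb -yx|exists x].
have [z' [Dz Vz]] := BD _ Bx V (open_nbhs_nbhs (conj oV Vx)).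
have [Kz [z _ zE]] := DB _ Dz; rewrite -{z'}zE in Dz Vz Kz.
have zK : ext_incl Y z \in f @^-1` K by rewrite inE /= fb.
exists (exist _ (ext_incl Y z) zK); split; last by right; rewrite /= fb.
by have : (ext_incl S @^-1` V) z := Vz; rewrite VW.
Qed.

(** The function [phi] is built from the points in [X] of a countable dense
    subset of [U]; thus [phi < 1] on the trace of the interior of [U]. Removing
    from it the compact part where [phi] is at least [e] leaves a neighbourhood
    of the added point of [Y] on which [phi < e]. This gives at once that [phi]
    has infimum 0 and that the map from [Y] to [S] is continuous. *)
Lemma separable_above_locally_compact Y :
  metrizable R X -> locally_compact [set: X] -> separable_at_pt Y ->
  exists2 S : extension R X, locally_compact [set: S] & ext_le S Y.
Proof.
move=> /metrizable_dist[d dX] lcX [U nU [D ctD dD]].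
pose E := [set x | exists2 u, D u & set_val u = ext_incl Y x].
have ctE : countable E.
  apply: (@countable_inj_on _ _ (ext_incl Y) _ (set_val @` D)).
  - exact: sub_countable (card_image_le _ _) ctD.
  - by move=> x [u Du ux]; exists u.
  - by move=> x y _ _ /ext_incl_inj.
have [phi [phi0 phic phicpt Ephi]] := vanishing_function dX lcX ctE.
have Uphi x : U° (ext_incl Y x) -> phi x < 1.
  move=> Ux; apply: Ephi => B; rewrite nbhsE => -[O [oO Ox] OB].
  have [V oV VO] := (ext_subspace Y O).1 oO.
  have Vx : (V `&` U° `&` range (ext_incl Y)) (ext_incl Y x).
    by split; [split=> //; rewrite -VO in Ox|exists x].
  have xU : ext_incl Y x \in U by rewrite inE; exact: interior_subset Ux.
  have [||u [[[Vu _] [z _ zu]] Du]] :=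
    dD (set_val @^-1` (V `&` U° `&` range (ext_incl Y))).
  - by exists (exist _ (ext_incl Y x) xU).
  - exists (V `&` U° `&` range (ext_incl Y)) => //.
    apply: openI; last exact: ext_range_open.
    by apply: openI => //; exact: open_interior.
  by exists z; split; [exists u|apply: OB; rewrite -VO /= zu].
have far e : 0 < e -> exists2 N, open_nbhs (ext_pt Y) N &
    forall x, N (ext_incl Y x) -> phi x < e.
  move=> /phicpt[C eC [cC _]].
  exists (U° `&` ~` (ext_incl Y @` C)).
    split; last first.
      by split=> // -[x _ xp]; apply: (@ext_pt_notin _ _ Y); exists x.
    apply: openI; first exact: open_interior.
    by apply: closed_openC; exact: ext_incl_closed.
  move=> x [/Uphi x1 Cx]; rewrite ltNge; apply/negP => ex; apply: Cx.
  by exists x => //; apply: eC; rewrite /= ex.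
have [|S nS] := one_point_extension dX phi0 phic.
  move=> e /far[N [oN Np] Ne].
  have [_ [/[swap] [[x _ <-]] Nx]] :=
    @ext_dense _ _ Y N (ex_intro _ _ Np) oN.
  by exists x; exact: Ne.
exists S.
  exact: adjoined_locally_compact lcX phi0 phic phicpt nS.
have /choice[f fP] y : exists s : S,
    (y = ext_pt Y /\ s = ext_pt S) \/
    exists x, y = ext_incl Y x /\ s = ext_incl S x.
  by case: (ext_case y) => [->|[x ->]];
    [exists (ext_pt S); left|exists (ext_incl S x); right; exists x].
have fb : fixes_base f.
  move=> x; have [[xp _]|[x' [/ext_incl_inj -> ->//]]] := fP (ext_incl Y x).
  by exfalso; apply: (@ext_pt_notin _ _ Y); exists x.
have fp : f (ext_pt Y) = ext_pt S.
  have [[]//|[x [xp _]]] := fP (ext_pt Y).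
  by exfalso; apply: (@ext_pt_notin _ _ Y); exists x.
exists f => // y V; have [->|[x ->]] := ext_case y.
  rewrite fp => /nS[Vp [e /far[N oN Ne] eV]].
  apply: filterS (open_nbhs_nbhs oN) => z Nz /=.
  have [zp|[x zx]] := ext_case z; first by rewrite zp fp.
  by rewrite zx fb; apply/eV/Ne; rewrite -zx.
rewrite fb => /ext_nbhs xV; apply/ext_nbhs; apply: filterS xV => z /=.
by rewrite fb.
Qed.

End extension_order.

Lemma extension_class (R : realType) (X : topologicalType)
    (S : extension R X) :
  exists C : calE R X, C S.
Proof.
have SP : exists Y, forall Z, ext_equiv S Z <-> ext_equiv Y Z by exists S.
by exists (ExtClass SP); exact: ext_equiv_refl.
Qed.

(* The equality of the two subsets of E(X) is stated elementwise. *)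
Theorem theorem5p4 (R : realType) (X : topologicalType)
    (X_metrizable : metrizable R X)
    (X_locally_compact : locally_compact [set: X])
    (X_nonseparable : ~ separable X) :
  forall Y : calE R X,
    calE_S Y <-> exists S : calE R X, calE_K S /\ calE_le S Y.
Proof.
move=> C; split=> [[Y CY sY]|[D [[S DS lcS] SC]]].
  have [S lcS SY] :=
    separable_above_locally_compact X_metrizable X_locally_compact sY.
  have [D DS] := extension_class S.
  by exists D; split; [exists S|exists S, Y].
have [Y0 Y0P] := ext_repP C.
have CY : C Y0 := (Y0P Y0).2 (ext_equiv_refl Y0).
exists Y0 => //; apply: locally_compact_le_separable lcS _.
exact/(calE_leP DS CY).
Qed.
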